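(* For every $r\ge1$ and every $j$ with $1\le j\le r$, $$\frac{(-1)^{r+j}}{j!\,(j-1)!}\cdot c_{\sigma_r}(r,j)=d(r,j),$$ where $d(r,j)$ denotes the Legendre–Stirling number and $\sigma_r=(r,r-1,\ldots,2,1)$ is the staircase shape of height $r$.
   Context: For a Ferrers shape $\lambda=(\lambda_1,\ldots,\lambda_r)$ (integers $\lambda_1\ge\cdots\ge\lambda_r\ge0$), the numbers $c_\lambda(i,j)$, $1\le i\le r$, $j\in\mathbb{Z}$, are defined by $c_\lambda(1,0)=-1$, $c_\lambda(1,1)=1$, $c_\lambda(1,j)=0$ for $j\notin\{0,1\}$, and for $1<i\le r$ $$c_\lambda(i,j)=j(j-1)^{\lambda_{i-1}-\lambda_i}\,c_\lambda(i-1,j-1)-(j+1)j^{\lambda_{i-1}-\lambda_i}\,c_\lambda(i-1,j),$$ with the convention $0^0=1$. The Legendre–Stirling numbers are $$d(i,j)=\sum_{\ell=1}^{j}\frac{(-1)^{\ell+j}(2\ell+1)(\ell^2+\ell)^i}{(\ell+j+1)!\,(j-\ell)!}.$$ *)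

(* Defs.v *)
From HB Require Import structures.
From mathcomp Require Import all_boot all_order all_algebra.

Set Implicit Arguments.
Unset Strict Implicit.
Unset Printing Implicit Defensive.

Import Order.TTheory GRing.Theory Num.Theory.

Local Open Scope ring_scope.

(* Zero parts are allowed; the height of a shape is the size of the sequence. *)
Record ferrers_shape := FerrersShape {
  parts :> seq nat;
  parts_sorted : sorted geq parts
}.

(* Rows are numbered from 1: part la 1 is the largest part. *)
Definition part (la : ferrers_shape) (i : nat) : nat := nth 0%N la i.-1.

(* Meaningful for 1 <= i <= size la, where the truncated subtraction is exact;
   the value 0 at i = 0 is junk. The convention 0 ^ 0 = 1 is that of ^+. *)
Fixpoint ferrers_c (la : ferrers_shape) (i : nat) (j : int) {struct i} : int :=
  match i with
  | 0 => 0
  | 1 => if j == 0 then -1 else if j == 1 then 1 else 0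
  | i'.+1 =>
      let e := (part la i' - part la i)%N in
      j * (j - 1) ^+ e * ferrers_c la i' (j - 1)
      - (j + 1) * j ^+ e * ferrers_c la i' j
  end.

Lemma staircase_sorted (r : nat) : sorted geq (rev (iota 1 r)).
Proof. by rewrite rev_sorted; exact: iota_sorted. Qed.

Definition staircase (r : nat) : ferrers_shape :=
  FerrersShape (staircase_sorted r).

Definition legendre_stirling (i j : nat) : rat :=
  \sum_(1 <= l < j.+1)
    ((-1) ^+ (l + j) * (2 * l + 1)%:R * (l ^ 2 + l)%:R ^+ i)
      / ((l + j + 1)`!%:R * (j - l)`!%:R).

(* Main.v *)
Require Import Defs.
From HB Require Import structures.
From mathcomp Require Import all_boot all_order all_algebra.
From mathcomp Require Import ring zify.

Set Implicit Arguments.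
Unset Strict Implicit.
Unset Printing Implicit Defensive.

Import Order.TTheory GRing.Theory Num.Theory.

Local Open Scope ring_scope.

(** Both sides obey the same triangular recurrence with the same first row.

    In the staircase any two consecutive rows differ by exactly one cell, so the
    recurrence defining c becomes
      c(i+1,j) = j (j-1) c(i,j-1) - (j+1) j c(i,j).
    The weight (-1)^(i+j) / (j! (j-1)!) turns this into
      e(i+1,j) = e(i,j-1) + j (j+1) e(i,j),
    since the factor j (j-1) is the ratio of the weights at j and j-1 and the
    sign absorbs the minus.  The Legendre-Stirling numbers satisfy this
    recurrence ([legendre_stirling_rec]), because
      l (l+1) = j (j+1) - (j-l) (j+l+1)
    and the product (j-l) (j+l+1) cancels one factor of each factorial in the
    denominator.  The first row is e(1,1) = 1 and e(1,j) = 0 for j > 1; that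
    d(1,j) = 0 for j > 1 comes from a telescoping sum
    ([legendre_stirling_row1_partial]).

    The induction on the row has to range over all columns j >= 1, including
    those with j > i, hence the whole first row is needed. *)

Lemma factr_neq0 (n : nat) : n`!%:R != 0 :> rat.
Proof. by rewrite pnatr_eq0 -lt0n fact_gt0. Qed.

Lemma natrS_neq0 (n : nat) : n%:R + 1 != 0 :> rat.
Proof. by rewrite natr1 pnatr_eq0. Qed.

(** Summand by summand: writing (l+1) l = (j+1) (j+2) - (j+1-l) (j+l+2), the
    second part lowers both factorials and flips the sign, which gives the
    summand of index l for column j; for l = j+1 that part is zero. *)
Lemma legendre_stirling_rec (i j : nat) :
  legendre_stirling i.+1 j.+1 =
    legendre_stirling i j
      + (j.+1 * j.+2)%:R * legendre_stirling i j.+1.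
Proof.
rewrite /legendre_stirling big_nat_recr //= [in RHS](@big_nat_recr _ _ _ j.+1) //=.
rewrite mulrDr addrA mulr_sumr -big_split /=; congr (_ + _); last first.
  have -> : (j.+1 ^ 2 + j.+1 = j.+1 * j.+2)%N by lia.
  by rewrite exprS; ring.
apply: eq_big_nat => l /andP[l_gt0]; rewrite ltnS => le_lj.
have [k ->] : exists k, j = (l + k)%N by exists (j - l)%N; lia.
have -> : ((l + k).+1 - l = k.+1)%N by lia.
have -> : (l + k - l = k)%N by lia.
have -> : (l + (l + k).+1 + 1 = (l + (l + k) + 1).+1)%N by lia.
have -> : (l + (l + k).+1 = (l + (l + k)).+1)%N by lia.
rewrite !factS !natrM !exprS; set s := (-1) ^+ _; set p := _%:R ^+ i.
have := factr_neq0 (l + (l + k) + 1); set a := _`!%:R => a_neq0.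
have := factr_neq0 k; set b := _`!%:R => b_neq0.
have := natrS_neq0 (l + (l + k) + 1); have := natrS_neq0 k.
rewrite -!natr1 !natrD natrX.
move=> k_neq0 m_neq0.
by field; rewrite a_neq0 b_neq0 k_neq0 m_neq0.
Qed.

(** Telescoping form of d(1,j): with
      G(l) = (-1)^(l+j+1) (l-1) l (l+1) / ((l+j)! (j-l)!)
    the l-th summand times j-1 is G(l+1) - G(l), and G(1) = 0.  The right side
    is G(n+1), written with the factor j-n so that it makes sense, and
    vanishes, at n = j. *)
Lemma legendre_stirling_row1_partial (j n : nat) : (n <= j)%N ->
  (j%:R - 1) * \sum_(1 <= l < n.+1)
    ((-1) ^+ (l + j) * (2 * l + 1)%:R * (l ^ 2 + l)%:R ^+ 1)
      / ((l + j + 1)`!%:R * (j - l)`!%:R)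
  = (-1) ^+ (n + j) * (n * n.+1 * n.+2)%:R * (j%:R - n%:R)
      / ((n + j + 1)`!%:R * (j - n)`!%:R) :> rat.
Proof.
elim: n => [|n IHn] lt_nj; first by rewrite big_geq // !mul0n !(mulr0, mul0r).
rewrite big_nat_recr //= mulrDr IHn ?(ltnW lt_nj) //.
have [k ->] : exists k, j = (n + k.+1)%N by exists (j - n.+1)%N; lia.
have -> : (n + k.+1 - n.+1 = k)%N by lia.
have -> : (n + k.+1 - n = k.+1)%N by lia.
have -> : (n.+1 + (n + k.+1) + 1 = (n + (n + k.+1) + 1).+1)%N by lia.
rewrite addSn !factS !natrM !exprS; set s := (-1) ^+ _.
have := factr_neq0 (n + (n + k.+1) + 1); set a := _`!%:R => a_neq0.
have := factr_neq0 k; set b := _`!%:R => b_neq0.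
have := natrS_neq0 (n + (n + k.+1) + 1); have := natrS_neq0 k.
rewrite !natrD !natrX !natrM -!natr1 !natrD -!natr1.
rewrite add0r => k_neq0 m_neq0.
by field; rewrite a_neq0 b_neq0 k_neq0 m_neq0.
Qed.

Lemma legendre_stirling_row1 (j : nat) :
  legendre_stirling 1 j = (j == 1)%:R.
Proof.
case: j => [|[|j]]; first by rewrite /legendre_stirling big_geq.
  by rewrite /legendre_stirling big_nat1.
have := legendre_stirling_row1_partial (leqnn j.+2).
rewrite subrr mulr0 mul0r => /eqP.
by rewrite mulf_eq0 -natr1 addrK pnatr_eq0 => /eqP.
Qed.

(** Unit row differences make the exponents in the recurrence of c equal to 1,
    and then the rescaled recurrence is that of the Legendre-Stirling numbers.
    In column 1 no rescaling of c(i,0) is available, but the factor j (j-1)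
    kills it, in agreement with the empty sum d(i,0). *)
Lemma ferrers_c_unit_steps (la : ferrers_shape) (r i j : nat) :
  (forall k, (0 < k < r)%N -> (part la k - part la k.+1 = 1)%N) ->
  (0 < i <= r)%N ->
  (-1) ^+ (i + j.+1) / (j.+1`!%:R * j`!%:R) * (ferrers_c la i j.+1%:Z)%:~R
    = legendre_stirling i j.+1 :> rat.
Proof.
move=> unit_steps; elim: i j => [//|[|i] IHi] j le_ir.
  rewrite legendre_stirling_row1.
  by case: j => [|j] //=; rewrite mulr0.
have cE x : ferrers_c la i.+2 x = x * (x - 1) * ferrers_c la i.+1 (x - 1)
    - (x + 1) * x * ferrers_c la i.+1 x.
  by rewrite [LHS]/= unit_steps.
have {}IHi m := IHi m (ltnW le_ir).
rewrite cE legendre_stirling_rec -IHi.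
have -> : j.+1%:Z - 1 = j%:Z by lia.
case: j => [|j].
  rewrite /legendre_stirling big_geq //= mulr0 mul0r !sub0r !add0r.
  rewrite rmorphN !rmorphM addSn exprS /=.
  by rewrite -[in 1%:~R]/(1%:Z); ring.
rewrite -IHi !factS !natrM addSn [in LHS]exprS addnS [in LHS]exprS.
move: (ferrers_c la i.+1 j.+1%:Z) (ferrers_c la i.+1 j.+2%:Z) => c1 c2.
rewrite !rmorphB !rmorphM !rmorphD /= -!pmulrn [in RHS]exprS.
have := factr_neq0 j; have := natrS_neq0 j; have := natrS_neq0 j.+1.
rewrite -!natr1; set a := _`!%:R; set s := (-1) ^+ (_ + _).
move=> j2_neq0 j1_neq0 a_neq0.
by field; rewrite a_neq0 j1_neq0 j2_neq0.
Qed.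

Lemma part_staircase (r i : nat) :
  (0 < i <= r)%N -> part (staircase r) i = (r.+1 - i)%N.
Proof.
move=> /andP[i_gt0 le_ir].
by rewrite /part nth_rev size_iota ?nth_iota; lia.
Qed.

Theorem corollary5p2 (r j : nat) (hr : (1 <= r)%N) (hj : (1 <= j <= r)%N) :
  (-1) ^+ (r + j) / (j`!%:R * (j.-1)`!%:R)
    * (ferrers_c (staircase r) r j%:Z)%:~R
  = legendre_stirling r j :> rat.
Proof.
case: j hj => [//|j] _ /=; apply: (@ferrers_c_unit_steps _ r) => [k lt_kr|].
  by rewrite !part_staircase; lia.
by rewrite hr leqnn.
Qed.
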